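(* Let $A$ be a finite-dimensional self-injective algebra over a field $k$ without semisimple blocks, let $I$ be a two-sided ideal of $A$, and let $\varphi\in\underline{\mathrm{Inn}}(A)$ be a stably inner automorphism. Then $\varphi(I)=I$, and $\varphi$ induces an inner automorphism on the quotient algebra $A/((0:I)+I)$.
   Context: Algebras are unital and associative; modules are finitely generated right modules. $(0:I)=\{a\in A\mid aI=0\}$ is the left annihilator of $I$. $A$ is without semisimple blocks if it cannot be written as $A=A_1\times A_2$ with $A_1$ a (nonzero) semisimple algebra. $\underline{\mathrm{mod}}\text{-}A$ is the quotient of $\mathrm{mod}\text{-}A$ by the ideal of homomorphisms factoring through a projective module. For an automorphism $\varphi$ of $A$, $\mathrm{res}_\varphi\colon M\mapsto M_\varphi$ is the functor replacing the right action on $M$ by $m*a=m\varphi(a)$, and $\underline{\mathrm{res}}_\varphi$ is the functor it induces on $\underline{\mathrm{mod}}\text{-}A$. The automorphism $\varphi$ is stably inner if $\underline{\mathrm{res}}_\varphi\cong\mathrm{Id}_{\underline{\mathrm{mod}}\text{-}A}$ as functors; $\underline{\mathrm{Inn}}(A)$ is the set of stably inner automorphisms. *)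

(* Defs.v *)
From HB Require Import structures.
From mathcomp Require Import all_boot all_order all_algebra all_field.
Set Implicit Arguments.
Unset Strict Implicit.
Unset Printing Implicit Defensive.
Import GRing.Theory.
Local Open Scope ring_scope.
Local Open Scope quotient_scope.

(* Categories whose hom-sets are setoids: [heq f g] is the equality of         *)
(* morphisms, so that a quotient category keeps the same underlying homs.      *)
Record category := Category {
  obj :> Type;
  hom : obj -> obj -> Type;
  heq : forall X Y : obj, hom X Y -> hom X Y -> Prop;
  idm : forall X : obj, hom X X;
  compose : forall X Y Z : obj, hom Y Z -> hom X Y -> hom X Z;
  heq_refl : forall (X Y : obj) (f : hom X Y), heq f f;
  heq_sym : forall (X Y : obj) (f g : hom X Y), heq f g -> heq g f;
  heq_trans : forall (X Y : obj) (f g h : hom X Y),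
    heq f g -> heq g h -> heq f h;
  compose_heq : forall (X Y Z : obj) (g g' : hom Y Z) (f f' : hom X Y),
    heq g g' -> heq f f' -> heq (compose g f) (compose g' f');
  compose1m : forall (X Y : obj) (f : hom X Y), heq (compose (idm Y) f) f;
  composem1 : forall (X Y : obj) (f : hom X Y), heq (compose f (idm X)) f;
  composeA : forall (X Y Z W : obj) (h : hom Z W) (g : hom Y Z) (f : hom X Y),
    heq (compose h (compose g f)) (compose (compose h g) f)
}.

Record functor (C D : category) := Functor {
  fobj :> C -> D;
  fmap : forall X Y : C, hom X Y -> hom (fobj X) (fobj Y);
  fmap_heq : forall (X Y : C) (f g : hom X Y), heq f g -> heq (fmap f) (fmap g);
  fmap_id : forall X : C, heq (fmap (idm X)) (idm (fobj X));
  fmap_compose : forall (X Y Z : C) (g : hom Y Z) (f : hom X Y),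
    heq (fmap (compose g f)) (compose (fmap g) (fmap f))
}.

Definition id_functor (C : category) : functor C C :=
  @Functor C C id (fun _ _ => id) (fun _ _ _ _ => id)
    (fun _ => heq_refl _) (fun _ _ _ _ _ => heq_refl _).

Definition is_iso (C : category) (X Y : C) (f : hom X Y) : Prop :=
  exists g : hom Y X, heq (compose g f) (idm X) /\ heq (compose f g) (idm Y).

Definition natural (C D : category) (F G : functor C D)
    (eta : forall X : C, hom (F X) (G X)) : Prop :=
  forall (X Y : C) (f : hom X Y),
    heq (compose (eta Y) (fmap F f)) (compose (fmap G f) (eta X)).

Definition functors_isomorphic (C D : category) (F G : functor C D) : Prop :=
  exists eta : forall X : C, hom (F X) (G X),
    natural eta /\ forall X : C, is_iso (eta X).

Section Modules.
Variables (k : fieldType) (A : falgType k).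

Definition finitely_generated (M : lmodType A^c) : Prop :=
  exists (n : nat) (g : 'I_n -> M),
    forall m : M, exists c : 'I_n -> A^c, m = \sum_i c i *: g i.

(* Right A-modules are left modules over the converse ring A^c: the right      *)
(* action m * a is [(a : A^c) *: m].                                           *)
Record fgmod := FgMod {
  fg_sort :> lmodType A^c;
  fg_gen : finitely_generated fg_sort
}.

Definition surjective (S T : Type) (f : S -> T) : Prop :=
  forall y, exists x, f x = y.

Definition projective (P : fgmod) : Prop :=
  forall (M N : fgmod) (p : {linear M -> N}) (f : {linear P -> N}),
    surjective p -> exists g : {linear P -> M}, p \o g =1 f.

Definition injective_module (Q : fgmod) : Prop :=
  forall (M N : fgmod) (i : {linear M -> N}) (f : {linear M -> Q}),
    injective i -> exists g : {linear N -> Q}, g \o i =1 f.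

Lemma regular_fg : finitely_generated (A^c)^o.
Proof.
exists 1%N, (fun=> 1) => m; exists (fun=> m).
by rewrite big_ord1 /GRing.scale /= mulr1.
Qed.

(* (A^c)^o is A acting on itself by right multiplication, i.e., A_A.           *)
Definition regular_module : fgmod := FgMod regular_fg.

Definition self_injective : Prop := injective_module regular_module.

Definition factors_through_projective (M N : fgmod) (h : M -> N) : Prop :=
  exists (P : fgmod) (u : {linear M -> P}) (v : {linear P -> N}),
    projective P /\ h =1 v \o u.

Definition stably_equal (M N : fgmod) (f g : {linear M -> N}) : Prop :=
  factors_through_projective (f \- g).

End Modules.


Definition mk_linear (R : pzRingType) (M N : lmodType R) (f : M -> N)
    (fL : linear f) : {linear M -> N} :=
  HB.pack f (GRing.isLinear.Build _ _ _ _ f fL).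

Section StableCategory.
Variables (k : fieldType) (A : falgType k).
Implicit Types M N P : fgmod A.

Lemma zero_fg : finitely_generated ('rV[A^c]_0 : lmodType A^c).
Proof.
exists 0%N, (fun=> 0) => m; exists (fun=> 0).
by rewrite big_ord0; apply/rowP; case.
Qed.

Definition zero_module : fgmod A := FgMod zero_fg.

Lemma zero_projective : projective zero_module.
Proof.
move=> M N p f _; exists (\0 : {linear _ -> _}) => x /=.
by rewrite [x](_ : x = 0) ?linear0 //; apply/rowP; case.
Qed.

Lemma sum_fg M N : finitely_generated ((M * N)%type : lmodType A^c).
Proof.
have [m [g hg]] := fg_gen M; have [n [h hh]] := fg_gen N.
pose gh (s : 'I_m + 'I_n) : M * N :=
  match s with inl i => (g i, 0) | inr j => (0, h j) end.
exists (m + n)%N, (fun i => gh (split i)) => -[x y].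
have [c ->] := hg x; have [d ->] := hh y.
exists (fun i => match split i with inl i => c i | inr j => d j end).
rewrite big_split_ord /=.
have El i : split (lshift n i) = inl i by exact: (unsplitK (inl i)).
have Er i : split (rshift m i) = inr i by exact: (unsplitK (inr i)).
under [X in _ = X + _]eq_bigr => i _ do rewrite El.
under [X in _ = _ + X]eq_bigr => i _ do rewrite Er.
have fstS (I : finType) (F : I -> M * N) : (\sum_i F i).1 = \sum_i (F i).1.
  exact: (raddf_sum fst).
have sndS (I : finType) (F : I -> M * N) : (\sum_i F i).2 = \sum_i (F i).2.
  exact: (raddf_sum snd).
apply: injective_projections; rewrite /= ?fstS ?sndS /=.
  by rewrite [X in _ = _ + X]big1 ?addr0 // => i _; rewrite scaler0.
by rewrite [X in _ = X + _]big1 ?add0r // => i _; rewrite scaler0.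
Qed.

Definition sum_module M N : fgmod A := FgMod (sum_fg M N).

Lemma sum_projective M N :
  projective M -> projective N -> projective (sum_module M N).
Proof.
move=> prM prN K L p f p_surj.
have inlL : linear (fun x : M => (x, 0) : sum_module M N).
  by move=> a x y; congr pair; rewrite /= scaler0 addr0.
have inrL : linear (fun y : N => (0, y) : sum_module M N).
  by move=> a x y; congr pair; rewrite /= scaler0 addr0.
have [g gE] := prM _ _ p (f \o mk_linear inlL) p_surj.
have [h hE] := prN _ _ p (f \o mk_linear inrL) p_surj.
have ghL : linear (fun z : sum_module M N => g z.1 + h z.2).
  by move=> a x y; rewrite /= !linearP scalerDr addrACA.
exists (mk_linear ghL) => -[x y] /=.
rewrite linearD; have /= -> := gE x; have /= -> := hE y.
by rewrite -linearD; congr (f _); congr pair; rewrite /= ?addr0 ?add0r.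
Qed.

Lemma factors_add M N (f g : M -> N) :
  factors_through_projective f -> factors_through_projective g ->
  factors_through_projective (f \+ g).
Proof.
move=> [P [u [v [prP fE]]]] [Q [u' [v' [prQ gE]]]].
have uL : linear (fun x => (u x, u' x) : sum_module P Q).
  by move=> a x y; rewrite !linearP.
have vL : linear (fun z : sum_module P Q => v z.1 + v' z.2).
  by move=> a x y; rewrite /= !linearP scalerDr addrACA.
exists (sum_module P Q), (mk_linear uL), (mk_linear vL).
by split=> [|x]; [exact: sum_projective | rewrite /= fE gE].
Qed.

Lemma stably_equal_refl M N (f : {linear M -> N}) : stably_equal f f.
Proof.
exists zero_module, \0, \0; split; first exact: zero_projective.
by move=> x; rewrite /= subrr.
Qed.

Lemma stably_equal_sym M N (f g : {linear M -> N}) :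
  stably_equal f g -> stably_equal g f.
Proof.
move=> [P [u [v [prP E]]]]; exists P, u, (\- v); split=> // x.
by rewrite /= -opprB; congr (- _); apply: E.
Qed.

Lemma stably_equal_trans M N (f g h : {linear M -> N}) :
  stably_equal f g -> stably_equal g h -> stably_equal f h.
Proof.
move=> fg gh; have [P [u [v [prP E]]]] := factors_add fg gh.
by exists P, u, v; split=> // x; have /= <- := E x; rewrite addrA subrK.
Qed.

Lemma stably_equal_comp M N P (g g' : {linear N -> P}) (f f' : {linear M -> N}) :
  stably_equal g g' -> stably_equal f f' -> stably_equal (g \o f) (g' \o f').
Proof.
move=> [Q [u [v [prQ E]]]] [Q' [u' [v' [prQ' E']]]].
have gf : factors_through_projective (g \o (f \- f')).
  by exists Q', u', (g \o v'); split=> // x; have /= -> := E' x.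
have gf' : factors_through_projective ((g \- g') \o f').
  by exists Q, (u \o f'), v; split=> // x; have /= <- := E (f' x).
have [R [w [z [prR EE]]]] := factors_add gf gf'.
by exists R, w, z; split=> // x; have /= <- := EE x; rewrite linearB addrA subrK.
Qed.

Lemma stably_equal_ext M N (f g : {linear M -> N}) : f =1 g -> stably_equal f g.
Proof.
move=> fg; exists zero_module, \0, \0; split; first exact: zero_projective.
by move=> x; rewrite /= fg subrr.
Qed.

Definition stable_category : category.
Proof.
refine (@Category (fgmod A) (fun M N => {linear M -> N}) (@stably_equal k A)
  (fun M => idfun) (fun M N P g f => g \o f)
  stably_equal_refl stably_equal_sym stably_equal_trans stably_equal_comp _ _ _).
- by move=> M N f; apply: stably_equal_ext.
- by move=> M N f; apply: stably_equal_ext.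
- by move=> M N P Q h g f; apply: stably_equal_ext.
Defined.

End StableCategory.

(* Automorphisms of the k-algebra A; elements of 'AEnd(A) are k-linear.        *)
Record automorphism (k : fieldType) (A : falgType k) := Automorphism {
  aut_val :> 'AEnd(A);
  aut_bij : bijective aut_val
}.

(* M_phi: the additive group of M with the right action m * a := m phi(a).     *)
Definition restriction (k : fieldType) (A : falgType k) (phi : 'AEnd(A))
  (M : lmodType A^c) : Type := M.

Section Restriction.
Variables (k : fieldType) (A : falgType k).

Section Lmodule.
Variables (phi : 'AEnd(A)) (M : lmodType A^c).
Local Notation Mphi := (restriction phi M).

HB.instance Definition _ := GRing.Zmodule.on Mphi.

Definition restriction_scale (a : A^c) (m : Mphi) : Mphi :=
  (phi a : A^c) *: (m : M).

Lemma restriction_scaleA a b m :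
  restriction_scale a (restriction_scale b m) = restriction_scale (a * b) m.
Proof. by rewrite /restriction_scale scalerA (rmorphM phi). Qed.

Lemma restriction_scale1 : left_id 1 restriction_scale.
Proof. by move=> m; rewrite /restriction_scale (rmorph1 phi) scale1r. Qed.

Lemma restriction_scaleDr : right_distributive restriction_scale +%R.
Proof. by move=> a m n; rewrite /restriction_scale scalerDr. Qed.

Lemma restriction_scaleDl m : {morph restriction_scale^~ m : a b / a + b}.
Proof. by move=> a b; rewrite /restriction_scale (rmorphD phi) scalerDl. Qed.

HB.instance Definition _ := GRing.Zmodule_isLmodule.Build A^c Mphi
  restriction_scaleA restriction_scale1 restriction_scaleDr restriction_scaleDl.

Lemma restriction_scaleE (a : A^c) (m : Mphi) :
  a *: m = (phi a : A^c) *: (m : M) :> M.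
Proof. by []. Qed.
End Lmodule.

Lemma restriction_map_linear (phi : 'AEnd(A)) (M N : lmodType A^c)
  (f : {linear M -> N}) :
  linear (f : restriction phi M -> restriction phi N).
Proof. by move=> a x y; exact: (linearP f). Qed.

Definition restriction_map (phi : 'AEnd(A)) (M N : lmodType A^c)
    (f : {linear M -> N}) : {linear restriction phi M -> restriction phi N} :=
  mk_linear (@restriction_map_linear phi M N f).

Variable phi : automorphism A.

Lemma restriction_fg (M : fgmod A) : finitely_generated (restriction phi M).
Proof.
have [n [g hg]] := fg_gen M; have [psi _ phiK] := aut_bij phi.
exists n, g => m; have [c ->] := hg m; exists (fun i => psi (c i)).
by apply: eq_bigr => i _; rewrite {2}/GRing.scale /= /restriction_scale phiK.
Qed.

Definition restriction_module (M : fgmod A) : fgmod A :=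
  FgMod (restriction_fg M).

Lemma inverse_automorphism :
  exists psi : automorphism A, cancel phi psi /\ cancel psi phi.
Proof.
have [g phiK gK] := aut_bij phi.
have gE : phi^-1%VF =1 g.
  move=> x; rewrite -{1}[x]gK; apply: lker0_lfunK.
  by apply/lker0P; apply: can_inj phiK.
have gM : ahom_in {:A} (phi^-1)%VF.
  apply/ahom_inP; split=> [x y _ _|]; rewrite !gE; apply: (can_inj phiK).
    by rewrite gK (rmorphM phi) /= !gK.
  by rewrite gK (rmorph1 phi).
have gB : bijective (AHom gM).
  by exists phi => x /=; rewrite gE.
by exists (Automorphism gB); split=> x; rewrite /= gE.
Qed.
End Restriction.

Section RestrictionFunctor.
Variables (k : fieldType) (A : falgType k) (phi : automorphism A).

Lemma restriction_projective (P : fgmod A) :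
  projective P -> projective (restriction_module phi P).
Proof.
move=> prP M N p f p_surj.
have [psi [phiK psiK]] := inverse_automorphism phi.
have fL : linear (f : P -> restriction_module psi N).
  move=> a x y; have := linearP f (psi a) x y.
  by rewrite restriction_scaleE psiK.
have [g gE] := prP (restriction_module psi M) (restriction_module psi N)
  (restriction_map psi p) (mk_linear fL) p_surj.
have gL : linear (g : restriction_module phi P -> M).
  move=> a x y; have := linearP g (phi a) x y.
  by rewrite [X in _ = X + _]restriction_scaleE phiK.
by exists (mk_linear gL).
Qed.

Lemma restriction_stably_equal (M N : fgmod A) (f g : {linear M -> N}) :
  stably_equal f g ->
  @stably_equal k A (restriction_module phi M) (restriction_module phi N)
    (restriction_map phi f) (restriction_map phi g).
Proof.
move=> [P [u [v [prP E]]]].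
exists (restriction_module phi P), (restriction_map phi u), (restriction_map phi v).
by split=> //; exact: restriction_projective.
Qed.

Definition stable_restriction :
  functor (stable_category A) (stable_category A).
Proof.
refine (@Functor (stable_category A) (stable_category A)
  (restriction_module phi)
  (fun (M N : fgmod A) (f : {linear M -> N}) => restriction_map phi f)
  restriction_stably_equal _ _).
- by move=> M; apply: stably_equal_ext.
- by move=> M N P g f; apply: stably_equal_ext.
Defined.

Definition stably_inner : Prop :=
  functors_isomorphic stable_restriction (id_functor (stable_category A)).
End RestrictionFunctor.

Section Ideals.
Variables (k : fieldType) (A : falgType k).
Implicit Types I J U V B C : {vspace A}.

(* One-sided and two-sided ideals of a unital k-algebra are k-subspaces.       *)
Definition two_sided_ideal I : bool :=
  ({:A} * I <= I)%VS && (I * {:A} <= I)%VS.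

Lemma two_sided_idealP I :
  reflect (forall a x, x \in I -> a * x \in I /\ x * a \in I)
          (two_sided_ideal I).
Proof.
apply: (iffP andP) => [[/prodvP lI /prodvP rI] a x xI|H].
  by split; [apply: lI | apply: rI]; rewrite ?memvf.
by split; apply/prodvP => a x ha hx; [case: (H a x hx) | case: (H x a ha)].
Qed.

(* The left annihilator (0 : I) = {a | a I = 0}.                               *)
Definition left_annihilator I : {vspace A} :=
  (\bigcap_(i < \dim I) lker (amulr (vbasis I)`_i))%VS.

Lemma left_annihilatorP I a :
  reflect (forall x, x \in I -> a * x = 0) (a \in left_annihilator I).
Proof.
apply: (iffP idP) => [/subv_bigcapP H x xI|H]; last first.
  apply/subv_bigcapP => i _; rewrite -memvE memv_ker lfunE /=.
  by rewrite H // vbasis_mem // mem_nth // size_tuple.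
rewrite (coord_vbasis xI) mulr_sumr big1 // => i _.
have := H i isT; rewrite -memvE memv_ker lfunE /= => /eqP E.
by rewrite -scalerAr E scaler0.
Qed.

Lemma left_annihilator_ideal I :
  two_sided_ideal I -> two_sided_ideal (left_annihilator I).
Proof.
move=> /two_sided_idealP idI; apply/two_sided_idealP => a x /left_annihilatorP xI.
split; apply/left_annihilatorP => y yI; rewrite -mulrA; first by rewrite xI ?mulr0.
by rewrite xI //; case: (idI a y yI).
Qed.

Lemma sum_ideal I J :
  two_sided_ideal I -> two_sided_ideal J -> two_sided_ideal (I + J)%VS.
Proof.
move=> /two_sided_idealP idI /two_sided_idealP idJ.
apply/two_sided_idealP => a x /memv_addP [u uI [v vJ ->]].
have [au ua] := idI a u uI; have [av va] := idJ a v vJ.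
by rewrite mulrDl mulrDr; split; apply: memv_add.
Qed.

(* For B a two-sided ideal that is a direct factor of A, the right B-submodules *)
(* of B are the U <= B with U B <= U, and B is a semisimple algebra iff each of *)
(* them is a direct summand of B_B.                                             *)
Definition semisimple B : Prop :=
  forall U, (U <= B)%VS -> (U * B <= U)%VS ->
    exists V, [/\ (V <= B)%VS, (V * B <= V)%VS,
                  (U + V = B)%VS & (U :&: V = 0)%VS].

(* A = B x C: internal direct product of algebras; C = 0 is allowed.           *)
Definition product_decomposition B C : Prop :=
  [/\ two_sided_ideal B, two_sided_ideal C,
      (B + C = {:A})%VS & (B :&: C = 0)%VS].

Definition without_semisimple_blocks : Prop :=
  ~ exists B C, [/\ product_decomposition B C, B != 0%VS & semisimple B].

Structure ideal := Ideal {
  ideal_val :> {vspace A};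
  ideal_two_sided : two_sided_ideal ideal_val
}.

End Ideals.

Definition annihilator_sum (k : fieldType) (A : falgType k) (I : ideal A) :
    ideal A :=
  Ideal (sum_ideal (left_annihilator_ideal (ideal_two_sided I))
                   (ideal_two_sided I)).

(* A / J may be the zero ring, whence the pzRingType structure below.           *)
Definition ideal_quotient (k : fieldType) (A : falgType k) (J : ideal A) : Type :=
  {ideal_quot (pred_of_vspace J : zmodClosed A)}.

Section QuotientRing.
Variables (k : fieldType) (A : falgType k) (J : ideal A).
Local Notation Q := (ideal_quotient J).

HB.instance Definition _ := EqQuotient.on Q.
HB.instance Definition _ := GRing.Zmodule.on Q.

Lemma quotient_eqP (a b : A) :
  reflect (\pi_Q a = \pi_Q b) (a - b \in ideal_val J).
Proof. by rewrite Quotient.idealrBE; exact: eqP. Qed.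

Definition quotient_one : Q := lift_cst Q 1.
Definition quotient_mul : Q -> Q -> Q := lift_op2 Q *%R.

Lemma quotient_oneE : quotient_one = \pi_Q 1.
Proof. by rewrite /quotient_one; unlock. Qed.

Lemma quotient_mulE (a b : A) :
  quotient_mul (\pi_Q a) (\pi_Q b) = \pi_Q (a * b).
Proof.
have /two_sided_idealP idJ := ideal_two_sided J.
rewrite /quotient_mul; unlock => /=.
apply/quotient_eqP; set a' := repr _; set b' := repr _.
have aJ : a' - a \in ideal_val J by apply/quotient_eqP; rewrite reprK.
have bJ : b' - b \in ideal_val J by apply/quotient_eqP; rewrite reprK.
have -> : a' * b' - a * b = a' * (b' - b) + (a' - a) * b.
  by rewrite mulrBr mulrBl addrA subrK.
by apply: memvD; [case: (idJ a' _ bJ) | case: (idJ b _ aJ)].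
Qed.

Lemma quotient_addE (a b : A) : \pi_Q a + \pi_Q b = \pi_Q (a + b).
Proof. exact: (esym (@Quotient.pi_add A (pred_of_vspace J : zmodClosed A) a b)). Qed.

Lemma quotient_mulA : associative quotient_mul.
Proof.
by move=> x y z; rewrite -[x]reprK -[y]reprK -[z]reprK !quotient_mulE mulrA.
Qed.

Lemma quotient_mul1 : left_id quotient_one quotient_mul.
Proof. by move=> x; rewrite -[x]reprK quotient_oneE quotient_mulE mul1r. Qed.

Lemma quotient_mulr1 : right_id quotient_one quotient_mul.
Proof. by move=> x; rewrite -[x]reprK quotient_oneE quotient_mulE mulr1. Qed.

Lemma quotient_mulDl : left_distributive quotient_mul +%R.
Proof.
move=> x y z; rewrite -[x]reprK -[y]reprK -[z]reprK.
by rewrite !(quotient_mulE, quotient_addE) mulrDl.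
Qed.

Lemma quotient_mulDr : right_distributive quotient_mul +%R.
Proof.
move=> x y z; rewrite -[x]reprK -[y]reprK -[z]reprK.
by rewrite !(quotient_mulE, quotient_addE) mulrDr.
Qed.

HB.instance Definition _ := GRing.Zmodule_isPzRing.Build Q
  quotient_mulA quotient_mul1 quotient_mulr1 quotient_mulDl quotient_mulDr.
End QuotientRing.

Definition inner_automorphism (R : pzRingType) (f : R -> R) : Prop :=
  exists u v : R, [/\ u * v = 1, v * u = 1 & forall x, f x = u * x * v].

Definition induces (k : fieldType) (A : falgType k) (phi : A -> A)
    (J : ideal A) (psi : ideal_quotient J -> ideal_quotient J) : Prop :=
  forall a : A, psi (\pi_(ideal_quotient J) a) = \pi_(ideal_quotient J) (phi a).

(* Main.v *)
(* Write psi = phi^-1. A homomorphism out of a cyclic module A/Y is left        *)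
(* multiplication by an element of A, and those that factor through a           *)
(* projective are given by elements c with c Y = 0. Hence the stable            *)
(* isomorphism (A/Y)_phi ~ A/Y amounts to d, t in A with d t = 1 + c mod Y and  *)
(* c Y = 0. For Y = I this makes d and t mutually inverse modulo (0 : I) + I,   *)
(* where naturality on the left multiplications reads d psi(a) = a d.           *)
(* For psi(I) <= I, take a right ideal Y containing I but not psi(I), maximal   *)
(* as such. The isomorphism at Y forces A/Y to be projective, so that           *)
(* Y = (1 - e)A with e idempotent, and e A has the simple socle e psi(I). The   *)
(* isomorphism at Y + psi(I), i.e., for e A modulo its socle, yields            *)
(* e psi(I) = 0, unless e A is simple; and then e A is also injective and       *)
(* generates a semisimple block.                                                *)
Require Import Defs.
From HB Require Import structures.
From mathcomp Require Import all_boot all_order all_algebra all_field.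
From mathcomp Require Import zify.
Set Implicit Arguments.
Unset Strict Implicit.
Unset Printing Implicit Defensive.
Import GRing.Theory.
Local Open Scope ring_scope.
Local Open Scope quotient_scope.

(** Everything is read off from the stable isomorphism at cyclic modules [A/Y]. By
    [stably_inner_cyclic] it is left multiplication by some [d], with stable inverse given by [t],
    up to errors [c] that kill the annihilator of a generator. Once psi(I) = I is known
    ([stably_inner_image]), the errors for Y = I lie in (0 : I). So [d] and [t] become mutually
    inverse modulo (0 : I) + I, and naturality d psi(a) = a d says that [phi] is conjugation by [d].

    For invariance, [no_maximal_counterexample] refutes a largest right ideal Y that contains I but
    not psi(I). By [maximal_dichotomy], every x either sends psi(I) into Y or generates A modulo Y.
    This and [annihilating_complement] give an idempotent e with right annihilator Y, so that e A is
    a copy of A/Y. Since [simple_projective_block] excludes a simple e A, e psi(I) psi(I) = 0. The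
    isomorphism at Y + psi(I) then forces e psi(I) = 0, that is, psi(I) inside Y. *)

Structure right_ideal (k : fieldType) (A : falgType k) := RightIdeal {
  right_ideal_val :> {vspace A};
  right_idealP : (right_ideal_val * {:A} <= right_ideal_val)%VS
}.

Lemma right_idealM (k : fieldType) (A : falgType k) (Y : right_ideal A) x a :
  x \in right_ideal_val Y -> x * a \in right_ideal_val Y.
Proof. by move=> xY; apply: (subvP (right_idealP Y)); rewrite memv_mul ?memvf. Qed.

(** * Cyclic right modules A/Y *)

Definition cyclic_quotient (k : fieldType) (A : falgType k) (Y : right_ideal A)
  : Type := {ideal_quot (pred_of_vspace Y : zmodClosed A)}.

Section CyclicQuotient.
Variables (k : fieldType) (A : falgType k) (Y : right_ideal A).
Local Notation Q := (cyclic_quotient Y).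

HB.instance Definition _ := EqQuotient.on Q.
HB.instance Definition _ := GRing.Zmodule.on Q.

Lemma cyclic_quotient_eqP (a b : A) :
  reflect (\pi_Q a = \pi_Q b) (a - b \in right_ideal_val Y).
Proof. by rewrite Quotient.idealrBE; exact: eqP. Qed.

Lemma cyclic_quotient_addE (a b : A) : \pi_Q (a + b) = \pi_Q a + \pi_Q b.
Proof. exact: (@Quotient.pi_add A (pred_of_vspace Y : zmodClosed A) a b). Qed.

Definition cyclic_quotient_scale (a : A^c) (q : Q) : Q :=
  \pi_Q ((repr q : A) * (a : A)).

Lemma cyclic_quotient_scaleE (a : A^c) (x : A) :
  cyclic_quotient_scale a (\pi_Q x) = \pi_Q (x * (a : A)).
Proof.
apply/cyclic_quotient_eqP; rewrite -mulrBl right_idealM //.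
by apply/cyclic_quotient_eqP; rewrite reprK.
Qed.

Lemma cyclic_quotient_scaleA a b q :
  cyclic_quotient_scale a (cyclic_quotient_scale b q) =
  cyclic_quotient_scale (a * b) q.
Proof.
by rewrite -[q]reprK (cyclic_quotient_scaleE b) !cyclic_quotient_scaleE -mulrA.
Qed.

Lemma cyclic_quotient_scale1 : left_id 1 cyclic_quotient_scale.
Proof. by move=> q; rewrite -[q]reprK cyclic_quotient_scaleE mulr1. Qed.

Lemma cyclic_quotient_scaleDr : right_distributive cyclic_quotient_scale +%R.
Proof.
move=> a p q; rewrite -[p]reprK -[q]reprK -cyclic_quotient_addE.
by rewrite !cyclic_quotient_scaleE mulrDl cyclic_quotient_addE.
Qed.

Lemma cyclic_quotient_scaleDl q :
  {morph cyclic_quotient_scale^~ q : a b / a + b}.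
Proof.
move=> a b; rewrite -[q]reprK !cyclic_quotient_scaleE.
by rewrite -cyclic_quotient_addE -mulrDr.
Qed.

HB.instance Definition _ := GRing.Zmodule_isLmodule.Build A^c Q
  cyclic_quotient_scaleA cyclic_quotient_scale1
  cyclic_quotient_scaleDr cyclic_quotient_scaleDl.

Lemma pi_scale (a : A^c) (x : A) : a *: \pi_Q x = \pi_Q (x * (a : A)).
Proof. exact: cyclic_quotient_scaleE. Qed.

Lemma pi_scale1 (x : A) : \pi_Q x = (x : A^c) *: \pi_Q 1.
Proof. by rewrite pi_scale mul1r. Qed.

Lemma cyclic_quotient_fg : finitely_generated Q.
Proof.
exists 1%N, (fun=> \pi_Q 1) => q; exists (fun=> repr q).
by rewrite big_ord1 -pi_scale1 reprK.
Qed.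

Definition cyclic_module : fgmod A := FgMod cyclic_quotient_fg.

Lemma pi_eq0P (x : A) : reflect (\pi_Q x = 0) (x \in right_ideal_val Y).
Proof.
have -> : 0 = \pi_Q 0 by rewrite -[LHS](scale0r (\pi_Q 1)) pi_scale mulr0.
by rewrite -{2}[x]subr0; exact: cyclic_quotient_eqP.
Qed.

Lemma pi_surj (q : Q) : exists x : A, q = \pi_Q x.
Proof. by exists (repr q); rewrite reprK. Qed.

(** Universal property of [A/Y]: the image [n] of the class of 1 can be any element killed by
    [Y]. *)
Lemma cyclic_lift (N : lmodType A^c) (n : N) :
    (forall y : A, y \in right_ideal_val Y -> (y : A^c) *: n = 0) ->
  exists f : {linear Q -> N}, forall x : A, f (\pi_Q x) = (x : A^c) *: n.
Proof.
move=> Yn; have E (x : A) : (repr (\pi_Q x) : A^c) *: n = (x : A^c) *: n.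
  apply/eqP; rewrite -subr_eq0 -scalerBl Yn //.
  by apply/cyclic_quotient_eqP; rewrite reprK.
have fL : linear (fun q : Q => (repr q : A^c) *: n).
  move=> a p q; rewrite -[p]reprK -[q]reprK pi_scale -cyclic_quotient_addE !E.
  by rewrite scalerDl scalerA.
by exists (mk_linear fL) => x; exact: E.
Qed.

End CyclicQuotient.

(** * Maps through projectives, and self-injectivity *)

Section Factoring.
Variables (k : fieldType) (A : falgType k).

Lemma row_fg n : finitely_generated ('rV[A^c]_n : lmodType A^c).
Proof.
exists n, (fun i => delta_mx 0 i) => m; exists (fun i => m 0 i).
exact: row_sum_delta.
Qed.

(** A projective module is a retract of a free one; the [u i] are the coordinates of [u] followed by
    a section [s]. *)
Lemma factors_through_projectiveP (M N : fgmod A) (h : M -> N) :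
  factors_through_projective h ->
  exists (n : nat) (u : 'I_n -> {linear M -> regular_module A}) (y : 'I_n -> N),
    forall m, h m = \sum_i (u i m : A^c) *: y i.
Proof.
move=> [P [u [v [prP hE]]]]; have [n [g gP]] := fg_gen P.
have pL : linear (fun r : FgMod (row_fg n) => \sum_i (r : 'rV__) 0 i *: g i : P).
  move=> a r s; rewrite scaler_sumr -big_split; apply: eq_bigr => i _.
  by rewrite !mxE scalerDl scalerA.
have p_surj : surjective (mk_linear pL).
  move=> m; have [c ->] := gP m; exists (\row_i c i).
  by apply: eq_bigr => i _; rewrite mxE.
have [s sE] := prP _ _ (mk_linear pL) idfun p_surj.
have uL i : linear (fun m : M => (s (u m) : 'rV[A^c]_n) 0 i : regular_module A).
  by move=> a x y; rewrite !linearP !mxE.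
exists n, (fun i => mk_linear (uL i)), (fun i => v (g i)) => m.
rewrite hE /= -{1}[u m](sE (u m)) /= linear_sum.
by apply: eq_bigr => i _; rewrite linearZ.
Qed.

(** The map w x -> e x is well defined on [wA], which is [A] modulo the right annihilator of [w].
    Injectivity extends it to [A], where it is left multiplication by the image [c] of 1. *)
Lemma self_injective_extend (w e : A) :
  self_injective A -> (forall x, w * x = 0 -> e * x = 0) ->
  exists c, c * w = e.
Proof.
move=> injA we.
have Yr : (lker (amull w) * {:A} <= lker (amull w))%VS.
  apply/prodvP => x a; rewrite !memv_ker !lfunE /= mulrA => /eqP -> _.
  by rewrite mul0r.
pose Y := RightIdeal Yr.
have YP x : (x \in right_ideal_val Y) = (w * x == 0) by rewrite memv_ker lfunE.
have [|i iE] := @cyclic_lift k A Y (regular_module A) w.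
  by move=> y; rewrite YP => /eqP.
have [|f fE] := @cyclic_lift k A Y (regular_module A) e.
  by move=> y; rewrite YP => /eqP /we.
have i_inj : injective i.
  apply: raddf_inj => q; have [x ->] := pi_surj q => ix0; apply/pi_eq0P.
  by rewrite YP; apply/eqP; rewrite -[LHS](iE x); exact: ix0.
have [g gE] := injA (cyclic_module Y) (regular_module A) i f i_inj.
have gw : g w = e.
  by have := gE (\pi 1); rewrite /= fE iE !scale1r.
exists (g 1); rewrite -gw -[in RHS](mul1r w).
exact/esym/(linearZ_LR g (w : A^c) 1).
Qed.
End Factoring.

(** The difference passes through a free module, and a linear map to [A] sends [m] to an element
    killed by the annihilator of [m]. *)
Lemma stably_equal_cyclic (k : fieldType) (A : falgType k) (M N : fgmod A)
    (f h : {linear M -> N}) (m : M) (n : N) :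
    (forall y : N, exists b : A^c, y = b *: n) -> stably_equal f h ->
  exists c : A, f m - h m = (c : A^c) *: n /\
    forall a : A, (a : A^c) *: m = 0 -> c * a = 0.
Proof.
move=> n_gen /factors_through_projectiveP [r [u [y /(_ m) /= ->]]].
pose K (z : N) := exists c : A, z = (c : A^c) *: n /\
  forall a : A, (a : A^c) *: m = 0 -> c * a = 0.
apply: (big_ind K).
- by exists 0; split=> [|a _]; rewrite ?scale0r ?mul0r.
- move=> _ _ [c [-> cP]] [d [-> dP]]; exists (c + d); split=> [|a am0].
    by rewrite -scalerDl.
  by rewrite mulrDl cP // dP // addr0.
- move=> i _; have [b ->] := n_gen (y i).
  exists ((b : A) * (u i m : A)); split=> [|a am0]; first by rewrite scalerA.
  have uma : (u i m : A) * a = 0.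
    by have /= := linearZ_LR (u i) (a : A^c) m; rewrite am0 linear0 => /esym.
  by rewrite -mulrA uma mulr0.
Qed.

(** * The stable isomorphism at a cyclic module *)

Section StablyInner.
Variables (k : fieldType) (A : falgType k) (phi : automorphism A).
Variable psi : A -> A.
Hypothesis psiK : cancel psi phi.

(** [d] and [t] represent the images of the generators under [eta] and its stable inverse. The
    inverse laws and naturality hold up to maps through projectives, whence the terms [c]. Each
    kills the annihilator of the generator of the source: [Y] for [A/Y], psi(Y) for its
    restriction. *)
Lemma stably_inner_cyclic (Y : right_ideal A) :
    stably_inner phi ->
  exists d t : A,
    [/\ forall y, y \in right_ideal_val Y -> d * psi y \in right_ideal_val Y,
        forall y, y \in right_ideal_val Y -> phi (t * y) \in right_ideal_val Y,
        exists2 c, (forall y, y \in right_ideal_val Y -> c * y = 0) &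
          d * t - 1 - c \in right_ideal_val Y,
        exists2 c, (forall y, y \in right_ideal_val Y -> c * psi y = 0) &
          phi (t * d - 1 - c) \in right_ideal_val Y &
        forall a,
          (forall y, y \in right_ideal_val Y -> a * y \in right_ideal_val Y) ->
          exists2 c, (forall y, y \in right_ideal_val Y -> c * psi y = 0) &
            d * psi a - a * d - c \in right_ideal_val Y].
Proof.
case=> eta [eta_nat eta_iso].
pose Q := cyclic_module Y; pose Qphi := restriction_module phi Q.
pose p (x : A) : Q := \pi_(cyclic_quotient Y) x.
(* Inserting [phi] makes [q x] the generator [q 1] acted on by [x] in the twisted module. *)
pose q (x : A) : Qphi := \pi_(cyclic_quotient Y) (phi x).
have p0 x : reflect (p x = 0) (x \in right_ideal_val Y) by exact: pi_eq0P.
have q0 x : reflect (q x = 0) (phi x \in right_ideal_val Y) by exact: pi_eq0P.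
have pB x y : p (x - y) = p x - p y.
  apply/eqP; rewrite eq_sym subr_eq /p -cyclic_quotient_addE subrK.
  exact: eqxx.
have qB x y : q (x - y) = q x - q y by rewrite /q (rmorphB phi); exact: pB.
have pM x y : p (x * y) = (y : A^c) *: p x by rewrite /p pi_scale.
have qM x y : q (x * y) = (y : A^c) *: q x.
  by rewrite /q (rmorphM phi); exact: pM.
have p_surj m : exists x, m = p x by exact: pi_surj.
have q_surj m : exists x, m = q x.
  by have [x ->] := p_surj m; exists (psi x); rewrite /q psiK.
have p_gen m : exists b : A^c, m = b *: p 1.
  by have [x ->] := p_surj m; exists x; rewrite -pM mul1r.
have q_gen m : exists b : A^c, m = b *: q 1.
  by have [x ->] := q_surj m; exists x; rewrite -qM mul1r.
have p_ann c y : (forall a : A, (a : A^c) *: p 1 = 0 -> c * a = 0) ->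
    y \in right_ideal_val Y -> c * y = 0.
  by move=> cP yY; apply: cP; rewrite -pM mul1r; apply/p0.
have q_ann c y : (forall a : A, (a : A^c) *: q 1 = 0 -> c * a = 0) ->
    y \in right_ideal_val Y -> c * psi y = 0.
  by move=> cP yY; apply: cP; rewrite -qM mul1r; apply/q0; rewrite psiK.
pose f : {linear Qphi -> Q} := eta Q.
have [g' [gf fg]] := eta_iso Q; pose g : {linear Q -> Qphi} := g'.
have [d fd] := p_surj (f (q 1)); have [t gt] := q_surj (g (p 1)).
have fE x : f (q x) = p (d * x).
  by rewrite -{1}[x]mul1r qM linearZ fd; exact/esym/pM.
have gE x : g (p x) = q (t * x).
  by rewrite -{1}[x]mul1r pM linearZ gt; exact/esym/qM.
exists d, t; split.
- move=> y yY; apply/p0; rewrite -fE -[RHS](linear0 f); congr (f _).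
  by apply/q0; rewrite psiK.
- move=> y yY; apply/q0; rewrite -gE -[RHS](linear0 g); congr (g _).
  exact/p0.
- have [c [/= cE cP]] := stably_equal_cyclic (p 1) p_gen fg.
  exists c => [y|]; first exact: (p_ann _ _ cP).
  have E : f (g (p 1)) - p 1 = (c : A^c) *: p 1 by exact: cE.
  by apply/p0; rewrite !pB -fE -gt E -pM mul1r subrr.
- have [c [/= cE cP]] := stably_equal_cyclic (q 1) q_gen gf.
  exists c => [y|]; first exact: (q_ann _ _ cP).
  have E : g (f (q 1)) - q 1 = (c : A^c) *: q 1 by exact: cE.
  by apply/q0; rewrite !qB -gE -fd E -qM mul1r subrr.
move=> a aY.
(* [l] is left multiplication by [a] on [A/Y], the map at which naturality is used. *)
have [y yY|l lE] := @cyclic_lift k A Y Q (p a).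
  by rewrite -pM; apply/p0; exact: aY.
have [c [/= cE cP]] := stably_equal_cyclic (q 1) p_gen (eta_nat Q Q l).
exists c => [y|]; first exact: (q_ann _ _ cP).
have l1 : l (q 1) = q (psi a).
  by rewrite /q (rmorph1 phi) lE scale1r psiK.
have l2 : l (f (q 1)) = p (a * d) by rewrite fd [LHS]lE -pM.
have E : f (l (q 1)) - l (f (q 1)) = (c : A^c) *: p 1 by exact: cE.
by apply/p0; rewrite !pB -fE -l1 -l2 E -pM mul1r subrr.
Qed.
End StablyInner.

(** * The block generated by a simple projective right ideal *)

Section Block.
Variables (k : fieldType) (A : falgType k) (e : A).
Hypotheses (A_selfinj : self_injective A) (ee : e * e = e).
Hypothesis eA_min : forall z, e * z != 0 -> exists b, e * z * b = e.

(* If h U <> U, then (1 - h) u e <> 0 for some u, and (1 - h) u e A is an       *)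
(* injective right ideal isomorphic to e A, which splits off to enlarge h A.    *)
Lemma idempotent_generator (U : {vspace A}) :
    (U * {:A} <= U)%VS -> (U <= (amulr e @: U) * {:A})%VS ->
  exists2 h, h \in U & forall u, u \in U -> h * u = u.
Proof.
move=> UA UeA.
have UM u a : u \in U -> u * a \in U.
  by move=> uU; apply: (subvP UA); rewrite memv_mul ?memvf.
suff H n h : h \in U -> h * h = h -> (dim A - \dim (limg (amull h)) < n)%N ->
    exists2 h, h \in U & forall u, u \in U -> h * u = u.
  by apply: (H (dim A).+1 0); rewrite ?mem0v ?mulr0 ?ltnS ?leq_subr.
elim: n h => // n IHn h hU hh; rewrite ltnS => le_n.
have [|/subvPn[u0 /memv_imgP[u uU ->]]] :=
    boolP (amulr e @: U <= lker (amull (1 - h)))%VS.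
  move=> Ue; exists h => // u uU; apply/eqP; rewrite eq_sym -subr_eq0.
  have : (U <= lker (amull (1 - h)))%VS.
    apply: subv_trans UeA _; apply/prodvP => x a /(subvP Ue).
    by rewrite !memv_ker !lfunE /= mulrA => /eqP-> _; rewrite mul0r.
  by move/subvP/(_ u uU); rewrite memv_ker lfunE /= mulrBl mul1r.
rewrite memv_ker !lfunE /= => w_neq0.
set w := (1 - h) * (u * e) in w_neq0.
have we : w * e = w by rewrite /w -!mulrA ee.
have hw : h * w = 0 by rewrite /w mulrA mulrBr mulr1 hh subrr mul0r.
have wU : w \in U.
  by rewrite /w mulrBl mul1r mulrA memvB ?UM.
clearbody w.
have [|c cw] := @self_injective_extend _ _ w e A_selfinj.
  move=> x wx; apply/eqP/negP => /negP /eA_min[b eb].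
  by case/eqP: w_neq0; rewrite -we -eb !mulrA we wx mul0r.
(* Since [c * w = e], [w * c] is idempotent with image [wA]; the factor [1 - h] makes it orthogonal
   to [h]. *)
pose g := w * c * (1 - h).
have hg : h * g = 0 by rewrite /g !mulrA hw !mul0r.
have gh : g * h = 0 by rewrite /g -mulrA mulrBl mul1r hh subrr mulr0.
have gw : g * w = w.
  by rewrite /g -mulrA mulrBl mul1r hw subr0 -mulrA cw we.
have gg : g * g = g by rewrite {2}/g !mulrA gw.
have ghU : h + g \in U by rewrite memvD // /g -mulrA UM.
have ghI : (h + g) * (h + g) = h + g.
  by rewrite mulrDl !mulrDr hh hg gh gg addr0 add0r.
apply: (IHn (h + g)) => //.
have lt_hg : (\dim (limg (amull h)) < \dim (limg (amull (h + g)%R)))%N.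
  have sub : (limg (amull h) <= limg (amull (h + g)%R))%VS.
    apply/subvP => _ /memv_imgP[x _ ->]; rewrite lfunE /=.
    have -> : h * x = amull (h + g) (h * x).
      by rewrite lfunE /= mulrA mulrDl hh gh addr0.
    exact/memv_img/memvf.
  rewrite (ltn_leqif (dimv_leqif_sup sub)); apply/negP => /subvP /(_ w).
  have -> : w = amull (h + g) w by rewrite lfunE /= mulrDl hw gw add0r.
  rewrite memv_img ?memvf // => /(_ isT) /memv_imgP[x _].
  rewrite !lfunE /= mulrDl hw gw add0r => wE.
  by case/eqP: w_neq0; rewrite -gw wE mulrA gh mul0r.
apply: leq_trans le_n.
by rewrite ltn_sub2l // (leq_trans lt_hg) // -dimvf dimvS ?subvf.
Qed.

(** The block is [B] = A e A. By [idempotent_generator] it has a left identity [f], which turns out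
    to be central. The same lemma gives every right ideal inside [B] an idempotent generator, hence
    a complement. *)
Lemma simple_projective_block : e != 0 -> ~ without_semisimple_blocks A.
Proof.
move=> e_neq0; apply.
pose B := ((amulr e @: {:A}) * {:A})%VS.
have BP a b : a * e * b \in B.
  apply: memv_mul; rewrite ?memvf //.
  by apply/memv_imgP; exists a; rewrite ?memvf ?lfunE.
have eB : e \in B by have := BP 1 1; rewrite mul1r mulr1.
have Br x a : x \in B -> x * a \in B.
  move=> xB; suff /subvP : (B * {:A} <= B)%VS by apply; rewrite memv_mul ?memvf.
  by rewrite /B -prodvA prodvSr ?subvf.
have Bl x a : x \in B -> a * x \in B.
  move=> xB; suff /subvP/(_ x xB) : (B <= amull a @^-1: B)%VS.
    by rewrite -memv_preim lfunE.
  apply/prodvP => _ b /memv_imgP[c _ ->] _.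
  by rewrite -memv_preim !lfunE /= !mulrA BP.
have idB : two_sided_ideal B by apply/two_sided_idealP => a x xB; split; auto.
have [f fB fE] : exists2 f, f \in B & forall u, u \in B -> f * u = u.
  apply: idempotent_generator; first by case/andP: idB.
  apply: prodvSl; apply/subvP => _ /memv_imgP[a _ ->].
  rewrite lfunE /= -[in a * e]ee mulrA; apply/memv_imgP; exists (a * e).
    by have := BP a 1; rewrite mulr1.
  by rewrite lfunE.
have ff : f * f = f by exact: fE.
(* Otherwise [e = e * b * (1 - f) * c] for some [c]. But [(1 - f) * c * e] lies in [B], so [f] both
   fixes and kills it; hence [e = e * e] would vanish. *)
have ebf b : e * b * (1 - f) = 0.
  apply/eqP/negP => /negP; rewrite -mulrA => /eA_min[c ec].
  have : f * ((1 - f) * c * e) = 0.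
    by rewrite !mulrA mulrBr mulr1 ff subrr !mul0r.
  rewrite fE => [g0|]; last by have := BP ((1 - f) * c) 1; rewrite mulr1.
  case/eqP: e_neq0; rewrite -ee -{1}ec.
  by rewrite -!mulrA in g0 *; rewrite g0 !mulr0.
have Ef u : u \in B -> u * f = u.
  move=> uB; apply/eqP; rewrite eq_sym -subr_eq0 -{1}[u]mulr1 -mulrBr.
  suff /subvP/(_ u uB) : (B <= lker (amulr (1 - f)))%VS by rewrite memv_ker lfunE.
  apply/prodvP => _ b /memv_imgP[c _ ->] _.
  by rewrite memv_ker !lfunE /= -!mulrA [e * _]mulrA ebf mulr0.
have fC a : f * a = a * f.
  by rewrite -[LHS]Ef ?Br // -mulrA fE ?Bl.
pose C := lker (amull f).
have CP x : (x \in C) = (f * x == 0) by rewrite memv_ker lfunE.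
exists B, C; split.
- split=> //.
  + apply/two_sided_idealP => a x; rewrite !CP => /eqP fx.
    by rewrite [f * (a * x)]mulrA (fC a) -mulrA fx mulr0 mulrA fx mul0r eqxx.
  + apply/eqP; rewrite eqEsubv subvf; apply/subvP => x _.
    rewrite -(subrK (f * x) x) addrC memv_add ?Br // CP.
    by rewrite mulrBr mulrA ff subrr.
  + apply/eqP; rewrite -subv0; apply/subvP => x; rewrite memv_cap CP memv0.
    by case/andP => /fE ->.
- by apply: contraNneq e_neq0 => B0; rewrite -memv0 -B0.
move=> U UB UrB.
have UA : (U * {:A} <= U)%VS.
  apply/prodvP => u a uU _; rewrite -[u]Ef ?(subvP UB) // -mulrA.
  by apply: (subvP UrB); rewrite memv_mul ?Br.
have [h hU hE] : exists2 h, h \in U & forall u, u \in U -> h * u = u.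
  apply: idempotent_generator => //; apply/subvP => u uU.
  rewrite -[u]Ef ?(subvP UB) //.
  suff /subvP : (B <= amull u @^-1: ((amulr e @: U) * {:A}))%VS.
    by move/(_ f fB); rewrite -memv_preim lfunE.
  apply/prodvP => _ b /memv_imgP[c _ ->] _; rewrite -memv_preim !lfunE /= !mulrA.
  apply: memv_mul; rewrite ?memvf //; apply/memv_imgP; exists (u * c).
    by apply: (subvP UA); rewrite memv_mul ?memvf.
  by rewrite lfunE.
exists (B :&: lker (amull h))%VS; split.
- exact: capvSl.
- apply/prodvP => x b; rewrite !memv_cap !memv_ker !lfunE /= => /andP[xB /eqP hx] _.
  by rewrite Br //= mulrA hx mul0r eqxx.
- apply/eqP; rewrite eqEsubv subv_add UB capvSl /=; apply/subvP => x xB.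
  rewrite -(subrK (h * x) x) addrC memv_add //.
    by apply: (subvP UA); rewrite memv_mul ?memvf.
  by rewrite memv_cap memvB ?Bl //= memv_ker lfunE /= mulrBr mulrA (hE h hU) subrr.
apply/eqP; rewrite -subv0; apply/subvP => x; rewrite !memv_cap memv_ker lfunE memv0 /=.
by case/and3P => /hE ->.
Qed.

End Block.

(** * Maximal right ideals not containing J, and splitting *)

Section Maximal.
Variables (k : fieldType) (A : falgType k) (I J : {vspace A}) (Y : right_ideal A).
Hypotheses (idI : two_sided_ideal I) (IY : (I <= Y)%VS).
Hypothesis Y_max : forall Z : right_ideal A,
  (I <= Z)%VS -> ~~ (J <= Z)%VS -> (\dim Z <= \dim Y)%N.

(** The right ideal of all [a] with [x * a] in [Y] contains [I]. If it does not contain [J], it is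
    no larger than [Y], so its quotient, which embeds in [A/Y] through [x], fills [A/Y]. *)
Lemma maximal_dichotomy x :
  (forall a, a \in J -> x * a \in right_ideal_val Y) \/
  (amull x @: {:A} + Y = {:A})%VS.
Proof.
pose Zs := (amull x @^-1: Y)%VS.
have ZP a : (a \in Zs) = (x * a \in right_ideal_val Y).
  by rewrite -memv_preim lfunE.
have Zr : (Zs * {:A} <= Zs)%VS.
  by apply/prodvP => a b; rewrite !ZP mulrA => /right_idealM.
have IZ : (I <= Zs)%VS.
  apply/subvP => a aI; rewrite ZP (subvP IY) //.
  by have /two_sided_idealP/(_ x a aI)[] := idI.
have [/subvP JZ|JZ] := boolP (J <= Zs)%VS.
  by left=> a /JZ; rewrite ZP.
right; have /= leZ := Y_max (Z := RightIdeal Zr) IZ JZ.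
apply/eqP; rewrite eqEdim subvf /=.
have d1 := limg_ker_dim (amull x) {:A}; have d2 := limg_ker_dim (amull x) Zs.
have KZ : (lker (amull x) <= Zs)%VS.
  by apply/subvP => a; rewrite memv_ker ZP lfunE /= => /eqP ->; rewrite mem0v.
rewrite capfv in d1; rewrite (capv_idPr KZ) in d2.
have cap : (amull x @: {:A} :&: Y <= amull x @: Zs)%VS.
  apply/subvP => z; rewrite memv_cap => /andP[/memv_imgP[a _ ->]].
  by rewrite {1}lfunE /= => aY; rewrite memv_img // ZP.
have := dimvS cap; have := dimv_sum_cap (amull x @: {:A}) Y.
lia.
Qed.
End Maximal.

(** As [Y] lies in the kernel of [c], counting dimensions makes cA + Y direct; [e] is the component
    of 1 in cA. *)
Lemma annihilating_complement (k : fieldType) (A : falgType k)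
    (Y : right_ideal A) (c : A) :
    (forall y, y \in right_ideal_val Y -> c * y = 0) ->
    (amull c @: {:A} + Y = {:A})%VS ->
  exists2 e, e * e = e & forall y, (y \in right_ideal_val Y) = (e * y == 0).
Proof.
move=> cY cA.
have YK : (Y <= lker (amull c))%VS.
  by apply/subvP => y /cY cy; rewrite memv_ker lfunE /= cy.
have cap0 : (amull c @: {:A} :&: Y = 0)%VS.
  apply/eqP; rewrite -dimv_eq0.
  have := limg_ker_dim (amull c) {:A}; rewrite capfv.
  have := dimv_sum_cap (amull c @: {:A}) Y; rewrite cA.
  by have := dimvS YK; lia.
have cM z a : z \in (amull c @: {:A})%VS -> z * a \in (amull c @: {:A})%VS.
  case/memv_imgP=> b _ ->; apply/memv_imgP; exists (b * a); rewrite ?memvf //.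
  by rewrite !lfunE /= mulrA.
have inter z : z \in (amull c @: {:A})%VS -> z \in right_ideal_val Y -> z = 0.
  by move=> zc zY; apply/eqP; rewrite -memv0 -cap0 memv_cap zc.
have : 1 \in (amull c @: {:A} + Y)%VS by rewrite cA memvf.
case/memv_addP=> e ec [y yY e1].
have ez z : z \in (amull c @: {:A})%VS -> e * z = z.
  move=> zc; apply/eqP; rewrite eq_sym -subr_eq0.
  have yz : z - e * z = y * z by rewrite -{1}[z]mul1r e1 mulrDl addrC addKr.
  apply/eqP/inter; first by rewrite memvB ?cM.
  by rewrite yz right_idealM.
exists e => [|z]; first exact: ez.
have ezE : e * z = z - y * z by rewrite -{2}[z]mul1r e1 mulrDl addrK.
apply/idP/eqP => [zY|ez0].
  by apply: inter; rewrite ?cM // ezE memvB ?right_idealM.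
by rewrite -[z]mul1r e1 mulrDl ez0 add0r right_idealM.
Qed.

(** * Invariance of two-sided ideals *)

Section Invariance.
Variables (k : fieldType) (A : falgType k) (phi : automorphism A).
Hypotheses (A_selfinj : self_injective A).
Hypotheses (A_nosemisimple : without_semisimple_blocks A).
Hypothesis phi_stably_inner : stably_inner phi.
Variable I : {vspace A}.
Hypothesis idI : two_sided_ideal I.

Lemma preimage_ideal : two_sided_ideal (phi @^-1: I).
Proof.
apply/two_sided_idealP => a x; rewrite -!memv_preim !(rmorphM phi) => xI.
by have /two_sided_idealP/(_ (phi a) _ xI) := idI.
Qed.

Lemma no_maximal_counterexample (Y : right_ideal A) :
    (I <= Y)%VS -> ~~ (phi @^-1: I <= Y)%VS ->
  ~ (forall Z : right_ideal A,
       (I <= Z)%VS -> ~~ (phi @^-1: I <= Z)%VS -> (\dim Z <= \dim Y)%N).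
Proof.
move=> IY JY Y_max.
have [psi [phiK psiK]] := inverse_automorphism phi.
have psiM : {morph psi : x y / x * y} by move=> x y; exact: (rmorphM psi).
have JP a : (a \in (phi @^-1: I)%VS) = (phi a \in I) by rewrite -memv_preim.
have /two_sided_idealP idI' := idI.
have /two_sided_idealP idJ := preimage_ideal.
have dich := maximal_dichotomy idI IY Y_max.
have noJ : ~ forall a, a \in (phi @^-1: I)%VS -> a \in right_ideal_val Y.
  by move/subvP; apply/negP.
have [e ee eP] : exists2 e, e * e = e &
    forall y, (y \in right_ideal_val Y) = (e * y == 0).
  have [d [t [dY _ [c cY dt] _ _]]] :=
    stably_inner_cyclic psiK Y phi_stably_inner.
  apply: (@annihilating_complement _ _ Y c cY); case: (dich c) => // cJ.
  (* If [c] sent psi(I) into [Y], then so would 1: [t * a] stays in psi(I), which [d] maps into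
     [Y]. *)
  case: noJ => a aJ.
  have : (d * t - 1 - c) * a \in right_ideal_val Y by exact: right_idealM.
  have dta : d * t * a \in right_ideal_val Y.
    have -> : d * t * a = d * psi (phi t * phi a).
      by rewrite -(rmorphM phi) /= phiK mulrA.
    by apply/dY/(subvP IY); case: (idI' (phi t) (phi a)); rewrite -?JP.
  have ca := cJ a aJ.
  rewrite !mulrBl mul1r => H.
  have -> : a = d * t * a - (d * t * a - a - c * a) - c * a.
    by rewrite -(addrA _ (- a)) -opprD subKr addrK.
  by apply: memvB (memvB dta H) ca.
have eY y : y \in right_ideal_val Y -> e * y = 0 by rewrite eP => /eqP.
have e_neq0 : e != 0.
  by apply/negP => /eqP e0; apply: noJ => a _; rewrite eP e0 mul0r.
have eJ i a : i \in (phi @^-1: I)%VS -> a \in (phi @^-1: I)%VS -> e * i * a = 0.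
  move=> iJ aJ; case: (dich (e * i)) => [eiY|eiA].
    by have := eY _ (eiY a aJ); rewrite !mulrA ee.
  (* Here [eA] is simple: a nonzero [e * z] enlarges [Y] to [W], which contains psi(I) by
     maximality, hence [i]; and [e * i] generates [eA]. *)
  case: (simple_projective_block A_selfinj ee _ e_neq0 A_nosemisimple) => z ez.
  have Wr : (((amull (e * z) @: {:A}) + Y) * {:A}
             <= (amull (e * z) @: {:A}) + Y)%VS.
    apply/prodvP => _ x /memv_addP[_ /memv_imgP[b _ ->] [y yY ->]] _.
    rewrite mulrDl memv_add ?right_idealM // lfunE /= -mulrA.
    by apply/memv_imgP; exists (b * x); rewrite ?memvf ?lfunE.
  pose W := RightIdeal Wr.
  have : (\dim Y < \dim W)%N.
    rewrite (ltn_leqif (dimv_leqif_sup _)) ?addvSr //; apply/subvPn.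
    exists (e * z); last by rewrite eP mulrA ee.
    rewrite -[e * z]addr0 memv_add ?mem0v //.
    by apply/memv_imgP; exists 1; rewrite ?memvf ?lfunE /= ?mulr1.
  rewrite ltnNge => /negP leW; have [/subvP JW|JW] := boolP (phi @^-1: I <= W)%VS.
    have : 1 \in (amull (e * i) @: {:A} + Y)%VS by rewrite eiA memvf.
    case/memv_addP=> _ /memv_imgP[b _ ->] [y yY]; rewrite lfunE /= => e1.
    have /memv_addP[_ /memv_imgP[x _ ->] [y' y'Y]] := JW i iJ.
    rewrite lfunE /= => iE; exists (x * b).
    have : e * i = e * z * x by rewrite {1}iE mulrDr (eY _ y'Y) addr0 !mulrA ee.
    rewrite mulrA => <-.
    by rewrite -[RHS]mulr1 e1 mulrDr (eY _ yY) addr0 !mulrA ee.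
  by case: leW; apply: Y_max => //; apply: subv_trans IY _; apply: addvSr.
have Zr : ((Y + phi @^-1: I) * {:A} <= Y + phi @^-1: I)%VS.
  apply/prodvP => _ x /memv_addP[y yY [i iJ ->]] _.
  by rewrite mulrDl memv_add ?right_idealM //; case: (idJ x i iJ).
have [d [t [dZ _ [c cZ dt] _ _]]] :=
  stably_inner_cyclic psiK (RightIdeal Zr) phi_stably_inner.
rewrite /= in dZ cZ dt.
apply: noJ => a aJ; rewrite eP.
have YZ y : y \in right_ideal_val Y -> y \in (Y + phi @^-1: I)%VS.
  exact/subvP/addvSl.
(* Subtracting this element turns [d * t] into [d * psi e * t], and [psi e * t] kills psi(I) because
   [e] kills [I]. *)
have z'Z : d * psi ((1 - e) * phi t) \in (Y + phi @^-1: I)%VS.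
  by apply/dZ/YZ/right_idealM; rewrite eP mulrBr mulr1 ee subrr.
have ezJ z : z \in (Y + phi @^-1: I)%VS -> e * z * a = 0.
  by case/memv_addP=> y yY [i iJ ->]; rewrite mulrDr (eY _ yY) add0r eJ.
have := ezJ _ (memvB dt z'Z).
have ca : c * a = 0 by apply/cZ; rewrite -[a]add0r memv_add ?mem0v.
have eta0 : psi e * t * a = 0.
  have -> : psi e * t * a = psi (e * phi (t * a)).
    by rewrite psiM phiK mulrA.
  rewrite eY ?(rmorph0 psi) //; apply: (subvP IY).
  by rewrite -JP; case: (idJ t a aJ).
rewrite psiM phiK (rmorphB psi) (rmorph1 psi).
rewrite -mulrA !mulrBl -!mulrA mulrBl !mulrBr !mul1r ca eta0 !mulr0 !subr0.
by rewrite addrAC subrr add0r => /eqP; rewrite oppr_eq0.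
Qed.

(** Induction on the codimension of [Y]: the right ideals larger than [Y] are already settled, so a
    failing [Y] would be a maximal counterexample. *)
Lemma stably_inner_preimage_sub : (phi @^-1: I <= I)%VS.
Proof.
suff H n (Y : right_ideal A) : (I <= Y)%VS -> (\dim {:A} - \dim Y < n)%N ->
    (phi @^-1: I <= Y)%VS.
  have Ir : (I * {:A} <= I)%VS by case/andP: idI.
  exact: (H (\dim {:A} - \dim I).+1 (RightIdeal Ir)).
elim: n Y => // n IHn Y IY leYn; apply/negPn/negP => JY.
apply: (no_maximal_counterexample IY JY) => Z IZ; apply: contraNT => ltYZ.
by apply: IHn => //; have := dimvS (subvf Z); lia.
Qed.

Lemma stably_inner_image : (phi @: I = I)%VS.
Proof.
have [psi [phiK psiK]] := inverse_automorphism phi.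
have ker0 : lker phi == 0%VS by apply/lker0P; exact: can_inj phiK.
have sub : (I <= phi @: I)%VS.
  apply/subvP => x xI; rewrite -[x]psiK memv_img //.
  by apply: (subvP stably_inner_preimage_sub); rewrite -memv_preim psiK.
apply/eqP; rewrite eq_sym eqEdim sub /=.
by rewrite limg_dim_eq // (eqP ker0) capv0.
Qed.
End Invariance.

Theorem corollary2p10 (k : fieldType) (A : falgType k)
  (A_selfinj : self_injective A)
  (A_nosemisimple : without_semisimple_blocks A)
  (I : ideal A) (phi : automorphism A) (phi_stably_inner : stably_inner phi) :
  (phi @: I)%VS = I /\
  exists psi : ideal_quotient (annihilator_sum I) -> ideal_quotient (annihilator_sum I),
    induces phi psi /\ inner_automorphism psi.
Proof.
have idI := ideal_two_sided I.
have phiI := stably_inner_image A_selfinj A_nosemisimple phi_stably_inner idI.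
split=> //.
have [psi [phiK psiK]] := inverse_automorphism phi.
have psiI y : y \in ideal_val I -> psi y \in ideal_val I.
  by rewrite -{1}phiI => /memv_imgP[x xI ->]; rewrite phiK.
have phiI' y : y \in ideal_val I -> phi y \in ideal_val I.
  by move=> yI; rewrite -phiI memv_img.
have /andP[_ Ir] := idI.
have /two_sided_idealP idI' := idI.
have [d [t [_ _ [c cI dt] [c' c'I td] nat]]] :=
  stably_inner_cyclic psiK (RightIdeal Ir) phi_stably_inner.
rewrite /= in cI dt c'I td nat.
set K := annihilator_sum I.
have sumK x b : (forall y, y \in ideal_val I -> b * y = 0) ->
    x - b \in ideal_val I -> x \in ideal_val K.
  move=> bI xb; rewrite -[x](subrK b) addrC memv_add //.
  exact/left_annihilatorP.
(* Since psi(I) = I, the errors from the twisted side also lie in (0 : I). *)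
have ann_psi b : (forall y, y \in ideal_val I -> b * psi y = 0) ->
    forall y, y \in ideal_val I -> b * y = 0.
  by move=> bI y yI; rewrite -[y]phiK bI ?phiI'.
pose pi (x : A) := \pi_(ideal_quotient K) x.
have piM x y : pi (x * y) = pi x * pi y by exact/esym/quotient_mulE.
have pi1 : pi 1 = 1 by exact/esym/quotient_oneE.
have dt1 : pi d * pi t = 1.
  by rewrite -piM -pi1; apply/quotient_eqP/(sumK _ _ cI).
have td1 : pi t * pi d = 1.
  rewrite -piM -pi1; apply/quotient_eqP/(sumK _ c'); first exact: ann_psi.
  by rewrite -[_ - _]phiK psiI.
have nat' a : pi d * pi (psi a) = pi a * pi d.
  rewrite -!piM; apply/quotient_eqP.
  have [y yI|b bI ab] := nat a; first by case: (idI' a y yI).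
  exact: (sumK _ _ (ann_psi _ bI)).
exists (fun x => pi d * x * pi t).
have E a : pi d * pi a * pi t = pi (phi a).
  by rewrite -{1}[a]phiK nat' -mulrA dt1 mulr1.
by split; [exact: E | exists (pi d), (pi t)].
Qed.
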